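(* Let $I=(0,1)$, $\mu>0$, $\gamma>1$, $\rho_0\in C(\bar I)$ with $\rho_0>0$ in $I$, $\rho_0=0$ on $\partial I$, and $u_0,\mathfrak e_0$ continuous with $\mathfrak e_0\ge0$, $\mathfrak e_0\not\equiv0$. Suppose there exist positive $\lambda_5,\lambda_6,\lambda_7,\lambda_8$ with $0<\lambda_7,\lambda_8<1$ such that either ($\frac{(\rho_0)_x}{\rho_0}+\frac{(\mathfrak e_0)_x}{\rho_0}\ge\lambda_5$ in $(0,\lambda_7)$, $v_0(\lambda_7)<0$, $v_0\le0$ in $(0,\lambda_7)$) or ($\frac{(\rho_0)_x}{\rho_0}+\frac{(\mathfrak e_0)_x}{\rho_0}\le-\lambda_6$ in $(\lambda_8,1)$, $v_0(\lambda_8)>0$, $v_0\ge0$ in $(\lambda_8,1)$), where $v_0=u_0$. Then for every $T>0$ the problem $$\rho_0v_t+\Big(\frac{\rho_0\mathfrak e}{\eta_x}\Big)_x=\mu\Big(\frac{v_x}{\eta_x}\Big)_x,\qquad \rho_0\mathfrak e_t+(\gamma-1)\frac{\rho_0\mathfrak e v_x}{\eta_x}=\mu\frac{v_x^2}{\eta_x}\qquad\text{in } I\times(0,T],$$ $$\eta_t=v,\qquad (v,\mathfrak e,\eta)=(u_0,\mathfrak e_0,x)\text{ on } I\times\{t=0\},\qquad v=v_x=0\text{ on }\partial I\times(0,T],$$ has no solution $(v,\mathfrak e,\eta)$ in $C^{2,1}(\bar I\times[0,T])$.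
   Context: $C^{2,1}(\bar I\times[0,T])$ denotes functions that are $C^2$ in $x$ and $C^1$ in $t$ on $\bar I\times[0,T]$. *)

(* Defs.v *)
From Stdlib Require Import Reals Lra.
Open Scope R_scope.

Definition deriv_within (D : R -> Prop) (f : R -> R) (x l : R) : Prop :=
  forall eps, 0 < eps -> exists delta, 0 < delta /\
    forall h, h <> 0 -> Rabs h < delta -> D (x + h) ->
      Rabs ((f (x + h) - f x) / h - l) < eps.

Definition closedI (x : R) : Prop := 0 <= x <= 1.
Definition openI (x : R) : Prop := 0 < x < 1.
Definition closedT (T t : R) : Prop := 0 <= t <= T.

Definition cont_rect (T : R) (f : R -> R -> R) : Prop :=
  forall x t, closedI x -> closedT T t ->
  forall eps, 0 < eps -> exists delta, 0 < delta /\
    forall y s, closedI y -> closedT T s ->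
      Rabs (y - x) < delta -> Rabs (s - t) < delta ->
      Rabs (f y s - f x t) < eps.

Definition C21 (T : R) (f fx fxx ft : R -> R -> R) : Prop :=
  cont_rect T f /\ cont_rect T fx /\ cont_rect T fxx /\ cont_rect T ft /\
  (forall x t, closedI x -> closedT T t ->
     deriv_within closedI (fun y => f y t) x (fx x t) /\
     deriv_within closedI (fun y => fx y t) x (fxx x t) /\
     deriv_within (closedT T) (fun s => f x s) t (ft x t)).

Definition cont_closedI (f : R -> R) : Prop :=
  forall x, closedI x -> forall eps, 0 < eps -> exists delta, 0 < delta /\
    forall y, closedI y -> Rabs (y - x) < delta -> Rabs (f y - f x) < eps.

(* Main.v *)
(** For small [t] one has [1/2 <= eta_x <= 2] and the energy equation keeps [e >= 0]. Let
    [m(x,t) = int_0^x rho0 v]. Since the stress [S = (mu v_x - rho0 e) / eta_x] vanishes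
    at [x = 0], the momentum equation gives [m_t = S <= (mu/2) v_x] wherever [v_x <= 0].
    Compare [m] with [- c int_0^x rho0 g], where [g = exp (b x + k t) - exp (b lam)]:
    with [k] of order [b^2] and [b] large, [- c g] is a strict supersolution of the
    integrated equation, [g <= 0] at [t = 0], and [g(0,t1) > 0]; a small [c] handles
    [x = lam], where [m < 0] because [u0 lam < 0]. Hence [int_0^x rho0 (v + c g) <= 0] up to
    time [t1], which is impossible for small [x] since [v(0,t1) = 0]. The vacuum boundary
    needs no care because the degenerate weight [rho0] stays inside the integral. The
    other end follows by the reflection [x -> 1 - x], [v -> - v]. *)
Require Import Defs.
From Stdlib Require Import Reals Lra ClassicalEpsilon.
From Coquelicot Require Import Coquelicot.
Open Scope R_scope.

(** * Extension from a closed interval or rectangle to the whole line or plane *)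

Definition clamp (a x : R) : R := Rmax 0 (Rmin a x).

Lemma clamp_in (a x : R) : 0 <= a -> 0 <= clamp a x <= a.
Proof.
  intros Ha; unfold clamp, Rmax, Rmin.
  destruct (Rle_dec a x); destruct (Rle_dec 0 _); lra.
Qed.

Lemma clamp_id (a x : R) : 0 <= x <= a -> clamp a x = x.
Proof.
  intros Hx; unfold clamp.
  rewrite Rmin_right by lra; apply Rmax_right; lra.
Qed.

Lemma clamp_lipschitz (a x y : R) : Rabs (clamp a x - clamp a y) <= Rabs (x - y).
Proof.
  unfold clamp, Rmax, Rmin.
  destruct (Rle_dec a x); destruct (Rle_dec a y);
    repeat destruct (Rle_dec 0 _); split_Rabs; lra.
Qed.

(** Projecting the arguments onto the rectangle is 1-Lipschitz, so the relative modulus of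
    continuity of [f] serves unchanged for the extension. Later arguments can then use continuity on
    the whole plane, with no domain conditions. *)
Lemma cont_rect_clamp (T : R) (f : R -> R -> R) :
  0 <= T -> cont_rect T f ->
  forall x t, continuity_2d_pt (fun y s => f (clamp 1 y) (clamp T s)) x t.
Proof.
  intros HT Hf x t eps.
  destruct (Hf (clamp 1 x) (clamp T t)
    (clamp_in 1 x Rle_0_1) (clamp_in T t HT) eps (cond_pos eps))
    as [d [Hd H]].
  exists (mkposreal d Hd); simpl; intros y s Hy Hs.
  apply H.
  - apply clamp_in; lra.
  - apply clamp_in; lra.
  - eapply Rle_lt_trans; [apply clamp_lipschitz | exact Hy].
  - eapply Rle_lt_trans; [apply clamp_lipschitz | exact Hs].
Qed.

Lemma cont_closedI_clamp (f : R -> R) :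
  cont_closedI f -> continuity (fun x => f (clamp 1 x)).
Proof.
  intros Hf x eps Heps.
  destruct (Hf (clamp 1 x) (clamp_in 1 x Rle_0_1) eps Heps) as [d [Hd H]].
  exists d; split; [exact Hd|]; intros y [_ Hy]; simpl in *; unfold R_dist in *.
  apply H.
  - apply clamp_in; lra.
  - eapply Rle_lt_trans; [apply clamp_lipschitz | exact Hy].
Qed.

(** * Slices and extrema of functions of two variables *)

Lemma continuity_2d_pt_fst (f : R -> R -> R) (x t : R) :
  continuity_2d_pt f x t -> continuity_pt (fun y => f y t) x.
Proof.
  intros Hf eps Heps.
  destruct (Hf (mkposreal eps Heps)) as [d H]; simpl in H.
  exists d; split; [apply cond_pos|]; intros y [_ Hy]; simpl in *; unfold R_dist in *.
  apply H; [exact Hy|].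
  rewrite Rminus_diag, Rabs_R0; apply cond_pos.
Qed.

Lemma continuity_2d_pt_snd (f : R -> R -> R) (x t : R) :
  continuity_2d_pt f x t -> continuity_pt (fun s => f x s) t.
Proof.
  intros Hf eps Heps.
  destruct (Hf (mkposreal eps Heps)) as [d H]; simpl in H.
  exists d; split; [apply cond_pos|]; intros y [_ Hy]; simpl in *; unfold R_dist in *.
  apply H; [|exact Hy].
  rewrite Rminus_diag, Rabs_R0; apply cond_pos.
Qed.

Lemma continuity_continuous (f : R -> R) (x : R) : continuity_pt f x -> continuous f x.
Proof. apply continuity_pt_filterlim. Qed.

Lemma ex_RInt_continuity (f : R -> R) (a b : R) : continuity f -> ex_RInt f a b.
Proof.
  intros Hf; apply (ex_RInt_continuous (V := R_CompleteNormedModule)).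
  intros x _; apply continuity_continuous, Hf.
Qed.

(** Maximise in [y] first and then in [x]. The maximiser [m x] is picked by choice and need not
    depend continuously on [x], but the maximal value [f x (m x)] does: slices of [f] at nearby
    points are uniformly close, and so are their maxima. *)
Lemma continuity_2d_rect_max (f : R -> R -> R) (a b c d : R) :
  a <= b -> c <= d -> (forall x y, continuity_2d_pt f x y) ->
  exists x0 y0, a <= x0 <= b /\ c <= y0 <= d /\
    forall x y, a <= x <= b -> c <= y <= d -> f x y <= f x0 y0.
Proof.
  intros Hab Hcd Hf.
  assert (Hy : forall x, exists y0,
      (forall y, c <= y <= d -> f x y <= f x y0) /\ c <= y0 <= d).
  { intros x; apply continuity_ab_maj; [exact Hcd|].
    intros y _; apply (continuity_2d_pt_snd f), Hf. }
  pose (m := fun x => proj1_sig (constructive_indefinite_description _ (Hy x))).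
  assert (Hm : forall x, (forall y, c <= y <= d -> f x y <= f x (m x)) /\ c <= m x <= d).
  { intros x; unfold m; destruct (constructive_indefinite_description _ (Hy x)); assumption. }
  destruct (continuity_ab_maj (fun x => f x (m x)) a b Hab) as [x0 [Hx0 Hin]].
  { intros x Hx eps Heps.
    (* Continuity at a point of [[a, b]] is two-sided on the line, so nearby points may leave the
       interval; the margin of 1 keeps them in the rectangle. *)
    destruct (uniform_continuity_2d f (a - 1) (b + 1) c d
      (fun u v _ _ => Hf u v) (mkposreal eps Heps)) as [e He]; simpl in He.
    exists (Rmin 1 e); split; [apply Rmin_pos; [lra | apply cond_pos]|].
    intros u [_ Hu]; simpl in *; unfold R_dist in *.
    assert (Hu1 : Rabs (u - x) < 1) by (eapply Rlt_le_trans; [exact Hu | apply Rmin_l]).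
    assert (Hue : Rabs (u - x) < e) by (eapply Rlt_le_trans; [exact Hu | apply Rmin_r]).
    assert (Hux : forall y, c <= y <= d -> Rabs (f u y - f x y) < eps).
    { intros y Hyd; apply He; try lra; split_Rabs; lra. }
    destruct (Hm u) as [Hmu Hmu']; destruct (Hm x) as [Hmx Hmx'].
    pose proof (Hux _ Hmu') as A1; pose proof (Hux _ Hmx') as A2.
    pose proof (Hmu _ Hmx'); pose proof (Hmx _ Hmu').
    split_Rabs; lra. }
  exists x0, (m x0); split; [exact Hin|]; split; [apply Hm|].
  intros x y Hx Hyd; eapply Rle_trans; [apply (Hm x), Hyd | apply Hx0, Hx].
Qed.

Lemma continuity_2d_rect_bounded (f : R -> R -> R) (a b c d : R) :
  (forall x y, continuity_2d_pt f x y) ->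
  exists M, forall x y, a <= x <= b -> c <= y <= d -> Rabs (f x y) <= M.
Proof.
  intros Hf.
  destruct (Rle_dec a b) as [Hab|Hab]; [|exists 0; intros; lra].
  destruct (Rle_dec c d) as [Hcd|Hcd]; [|exists 0; intros; lra].
  destruct (continuity_2d_rect_max (fun x y => Rabs (f x y)) a b c d Hab Hcd)
    as [x0 [y0 [_ [_ H]]]].
  { intros x y; apply (continuity_1d_2d_pt_comp Rabs); [apply Rcontinuity_abs | apply Hf]. }
  exists (Rabs (f x0 y0)); exact H.
Qed.

(** * Integrals with a variable endpoint and a parameter *)

Lemma Rabs_RInt_le_bound (f : R -> R) (a b M : R) :
  continuity f -> (forall t, Rmin a b <= t <= Rmax a b -> Rabs (f t) <= M) ->
  Rabs (RInt f a b) <= Rabs (b - a) * M.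
Proof.
  intros Hf HM.
  destruct (Rle_dec a b) as [Hab|Hab].
  - rewrite Rmin_left, Rmax_right in HM by lra.
    rewrite (Rabs_pos_eq (b - a)) by lra.
    apply abs_RInt_le_const; [lra | apply ex_RInt_continuity, Hf | exact HM].
  - rewrite Rmin_right, Rmax_left in HM by lra.
    rewrite <- opp_RInt_swap by apply ex_RInt_continuity, Hf.
    change (Rabs (- RInt f b a) <= Rabs (b - a) * M).
    rewrite Rabs_Ropp, (Rabs_left1 (b - a)) by lra.
    replace (- (b - a)) with (a - b) by ring.
    apply abs_RInt_le_const; [lra | apply ex_RInt_continuity, Hf | exact HM].
Qed.

(** The increment splits into a change of integrand on [[0, x]], small by uniform continuity, and an
    integral over the short interval from [x] to [u], small because [f] is bounded by [M]. Each part
    receives half of [eps]. *)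
Lemma continuity_2d_RInt (f : R -> R -> R) :
  (forall x t, continuity_2d_pt f x t) ->
  forall x t, continuity_2d_pt (fun x t => RInt (fun y => f y t) 0 x) x t.
Proof.
  intros Hf x t eps.
  assert (Hc : forall s, continuity (fun y => f y s)).
  { intros s y; apply (continuity_2d_pt_fst f), Hf. }
  set (r := Rabs x + 1).
  assert (Hr : 0 < r) by (unfold r; pose proof (Rabs_pos x); lra).
  destruct (continuity_2d_rect_bounded f (- r) r (t - 1) (t + 1) Hf) as [M HM].
  assert (HM0 : 0 <= M).
  { eapply Rle_trans; [apply Rabs_pos | apply (HM 0 t); lra]. }
  assert (He : 0 < eps / (2 * r)).
  { apply Rdiv_lt_0_compat; [apply cond_pos | lra]. }
  destruct (uniform_continuity_2d f (- r) r (t - 1) (t + 1)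
    (fun u v _ _ => Hf u v) (mkposreal _ He)) as [d Hd]; simpl in Hd.
  assert (Hd0 : 0 < Rmin (Rmin 1 d) (eps / (2 * (M + 1)))).
  { apply Rmin_pos; [apply Rmin_pos; [lra | apply cond_pos]|].
    apply Rdiv_lt_0_compat; [apply cond_pos | lra]. }
  exists (mkposreal _ Hd0); simpl; intros u s Hu Hs.
  pose proof (Rmin_l (Rmin 1 d) (eps / (2 * (M + 1)))).
  pose proof (Rmin_r (Rmin 1 d) (eps / (2 * (M + 1)))).
  pose proof (Rmin_l 1 d). pose proof (Rmin_r 1 d).
  pose proof (cond_pos d) as Hdp. pose proof (cond_pos eps) as Hep.
  assert (E : RInt (fun y => f y s) 0 u - RInt (fun y => f y t) 0 x
    = RInt (fun y => f y s - f y t) 0 x + RInt (fun y => f y s) x u).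
  { rewrite <- (RInt_Chasles (fun y => f y s) 0 x u)
      by (apply ex_RInt_continuity, Hc).
    rewrite (RInt_minus (fun y => f y s) (fun y => f y t))
      by (apply ex_RInt_continuity, Hc).
    unfold minus, plus, opp; simpl; ring. }
  rewrite E.
  assert (A1 : Rabs (RInt (fun y => f y s - f y t) 0 x) <= Rabs (x - 0) * (eps / (2 * r))).
  { apply Rabs_RInt_le_bound.
    - intros y; apply continuity_pt_minus; apply Hc.
    - intros y Hy.
      assert (- r <= y <= r).
      { revert Hy; unfold Rmin, Rmax, r; destruct (Rle_dec 0 x); split_Rabs; lra. }
      left; apply Hd; try lra; split_Rabs; lra. }
  assert (A2 : Rabs (RInt (fun y => f y s) x u) <= Rabs (u - x) * M).
  { apply Rabs_RInt_le_bound; [apply Hc|].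
    intros y Hy; apply HM; [|split_Rabs; lra].
    revert Hy; unfold Rmin, Rmax, r; destruct (Rle_dec x u); split_Rabs; lra. }
  assert (A3 : Rabs (x - 0) * (eps / (2 * r)) <= eps / 2).
  { rewrite Rminus_0_r.
    apply Rle_trans with (r * (eps / (2 * r))).
    - apply Rmult_le_compat_r; [lra | unfold r; lra].
    - right; field; lra. }
  assert (A4 : Rabs (u - x) * M < eps / 2).
  { apply Rle_lt_trans with (eps / (2 * (M + 1)) * M).
    - apply Rmult_le_compat_r; lra.
    - apply Rmult_lt_reg_r with (2 * (M + 1)); [lra|].
      replace (eps / (2 * (M + 1)) * M * (2 * (M + 1))) with (eps * M) by (field; lra).
      lra. }
  eapply Rle_lt_trans; [apply Rabs_triang | lra].
Qed.

Lemma is_derive_RInt_upper (f : R -> R) (x : R) :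
  continuity f -> is_derive (fun u => RInt f 0 u) x (f x).
Proof.
  intros Hf; apply (is_derive_RInt f (fun u => RInt f 0 u) 0 x).
  - apply filter_forall; intros u; apply (RInt_correct (V := R_CompleteNormedModule)).
    apply ex_RInt_continuity, Hf.
  - apply continuity_continuous, Hf.
Qed.

(** Differentiation under the integral sign. Since [ft] is the time derivative only for times in
    [(0, T)], it is identified with [Derive] merely near [t], which suffices for the required joint
    continuity. *)
Lemma is_derive_RInt_time (f ft : R -> R -> R) (T x t : R) :
  0 < t < T ->
  (forall s, continuity (fun y => f y s)) ->
  (forall y s, continuity_2d_pt ft y s) ->
  (forall y s, 0 < s < T -> is_derive (fun r => f y r) s (ft y s)) ->
  is_derive (fun s => RInt (fun y => f y s) 0 x) t (RInt (fun y => ft y t) 0 x).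
Proof.
  intros Ht Hf Hft Hd.
  assert (Hloc : locally t (fun s => 0 < s < T)).
  { apply (open_and (fun s => 0 < s) (fun s => s < T));
      [apply open_gt | apply open_lt | exact Ht]. }
  replace (RInt (fun y => ft y t) 0 x)
    with (RInt (fun y => Derive (fun s => f y s) t) 0 x).
  2:{ apply RInt_ext; intros y _; apply is_derive_unique, Hd, Ht. }
  apply (is_derive_RInt_param (fun s y => f y s)).
  - revert Hloc; apply filter_imp; intros s Hs y _; eexists; apply Hd, Hs.
  - intros y _.
    apply continuity_2d_pt_ext_loc with (fun s y => ft y s).
    + destruct Hloc as [d Hl]; exists d; intros s z Hs _.
      symmetry; apply is_derive_unique, Hd, Hl, Hs.
    + intros eps; destruct (Hft y t eps) as [d H].
      exists d; intros s z Hs Hz; apply H; assumption.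
  - apply filter_forall; intros s; apply ex_RInt_continuity, Hf.
Qed.

(** * Derivative tests and the maximum principle for weighted integrals *)

Lemma is_derive_left_max (f : R -> R) (t l d : R) :
  0 < d -> (forall s, t - d <= s <= t -> f s <= f t) -> is_derive f t l -> 0 <= l.
Proof.
  intros Hd Hmax Hder; apply is_derive_Reals in Hder.
  destruct (Rle_dec 0 l) as [|Hl]; [assumption|exfalso].
  destruct (Hder (- l)) as [e He]; [lra|].
  set (h := Rmin (e / 2) d).
  assert (Hh : 0 < h) by (apply Rmin_pos; [pose proof (cond_pos e); lra | exact Hd]).
  pose proof (Rmin_l (e / 2) d); pose proof (Rmin_r (e / 2) d).
  pose proof (cond_pos e); fold h in H, H0.
  assert (Hq : Rabs ((f (t + - h) - f t) / - h - l) < - l).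
  { apply He; [lra|]; rewrite Rabs_Ropp, Rabs_pos_eq; lra. }
  assert (Hs : f (t + - h) <= f t) by (apply Hmax; lra).
  assert (0 <= (f (t + - h) - f t) / - h).
  { replace ((f (t + - h) - f t) / - h) with ((f t - f (t + - h)) / h) by (field; lra).
    apply Rdiv_le_0_compat; lra. }
  split_Rabs; lra.
Qed.

Lemma is_derive_pos_right (f : R -> R) (x l : R) :
  is_derive f x l -> 0 < l ->
  exists d, 0 < d /\ forall y, x < y < x + d -> f x < f y.
Proof.
  intros Hder Hl; apply is_derive_Reals in Hder.
  destruct (Hder l Hl) as [d Hd].
  exists d; split; [apply cond_pos|]; intros y Hy.
  assert (Hq : Rabs ((f (x + (y - x)) - f x) / (y - x) - l) < l).
  { apply Hd; [lra|]; rewrite Rabs_pos_eq; lra. }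
  replace (x + (y - x)) with y in Hq by ring.
  assert (0 < (f y - f x) / (y - x)) by (split_Rabs; lra).
  assert (0 < (f y - f x) / (y - x) * (y - x)) by (apply Rmult_lt_0_compat; lra).
  replace ((f y - f x) / (y - x) * (y - x)) with (f y - f x) in * by (field; lra).
  lra.
Qed.

Lemma RInt_nonpos (f : R -> R) (a b : R) :
  a <= b -> continuity f -> (forall x, a < x < b -> f x <= 0) -> RInt f a b <= 0.
Proof.
  intros Hab Hf H.
  replace 0 with (RInt (fun _ => 0) a b) by (rewrite RInt_const; unfold scal; simpl; unfold mult; simpl; ring).
  apply RInt_le; [exact Hab | apply ex_RInt_continuity, Hf | | exact H].
  apply ex_RInt_const.
Qed.

(** At a positive interior maximum of [Z = int_0^x rho u] the first and second order
    conditions in [x] read [u = 0] and [ux <= 0], as [Z_x = rho u] with [rho > 0]. *)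
Lemma integrated_max_principle (rho : R -> R) (u ux ut : R -> R -> R) (lam t1 T : R) :
  0 < lam -> 0 < t1 < T ->
  continuity rho -> (forall x, 0 < x < lam -> 0 < rho x) ->
  (forall x t, continuity_2d_pt u x t) -> (forall x t, continuity_2d_pt ut x t) ->
  (forall x t, 0 < x < lam -> 0 < t < T -> is_derive (fun y => u y t) x (ux x t)) ->
  (forall x t, 0 < t < T -> is_derive (fun s => u x s) t (ut x t)) ->
  (forall x t, 0 < x < lam -> 0 < t <= t1 -> u x t = 0 -> ux x t <= 0 ->
     RInt (fun y => rho y * ut y t) 0 x < 0) ->
  (forall t, 0 <= t <= t1 -> RInt (fun y => rho y * u y t) 0 lam <= 0) ->
  (forall x, 0 <= x <= lam -> RInt (fun y => rho y * u y 0) 0 x <= 0) ->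
  forall x t, 0 <= x <= lam -> 0 <= t <= t1 -> RInt (fun y => rho y * u y t) 0 x <= 0.
Proof.
  intros Hlam Ht1 Hrho Hpos Hu Hut Hux Hutd Hsub Hlat Hini x t Hx Ht.
  assert (Hrho2 : forall x t, continuity_2d_pt (fun y _ => rho y) x t).
  { intros y s; apply (continuity_1d_2d_pt_comp rho (fun y _ => y));
      [apply Hrho | apply continuity_2d_pt_id1]. }
  assert (Hf : forall x t, continuity_2d_pt (fun y s => rho y * u y s) x t).
  { intros y s; apply continuity_2d_pt_mult; auto. }
  assert (Hc : forall s, continuity (fun y => rho y * u y s)).
  { intros s y; apply (continuity_2d_pt_fst (fun y s => rho y * u y s)), Hf. }
  pose (Z := fun x t => RInt (fun y => rho y * u y t) 0 x).
  destruct (continuity_2d_rect_max Z 0 lam 0 t1) as [a [s [Ha [Hs Hmax]]]]; [lra | lra | |].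
  { apply (continuity_2d_RInt (fun y s => rho y * u y s)), Hf. }
  destruct (Rle_dec (Z a s) 0) as [Hle|Hgt].
  { eapply Rle_trans; [apply (Hmax x t Hx Ht) | exact Hle]. }
  exfalso; apply Rnot_le_lt in Hgt.
  assert (Ha0 : a <> 0).
  { intros E; subst a; unfold Z in Hgt; rewrite RInt_point in Hgt; unfold zero in Hgt; simpl in Hgt; lra. }
  assert (Ha1 : a <> lam) by (intros E; subst a; specialize (Hlat s Hs); unfold Z in Hgt; lra).
  assert (Hs0 : s <> 0) by (intros E; subst s; specialize (Hini a Ha); unfold Z in Hgt; lra).
  assert (Ha' : 0 < a < lam) by lra.
  assert (Hs' : 0 < s < T) by lra.
  assert (HZx : forall y, is_derive (fun y => Z y s) y (rho y * u y s)).
  { intros y; apply (is_derive_RInt_upper (fun y => rho y * u y s)), Hc. }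
  assert (Hu0 : u a s = 0).
  { assert (pr : derivable_pt (fun y => Z y s) a).
    { exists (rho a * u a s); apply is_derive_Reals, HZx. }
    pose proof (deriv_maximum (fun y => Z y s) 0 lam a pr (proj1 Ha') (proj2 Ha')
      (fun y H1 H2 => Hmax y s (conj (Rlt_le _ _ H1) (Rlt_le _ _ H2)) Hs)) as E.
    rewrite (derive_pt_eq_0 _ _ (rho a * u a s) pr) in E by (apply is_derive_Reals, HZx).
    destruct (Rmult_integral _ _ E) as [E'|E']; [|exact E'].
    specialize (Hpos a Ha'); lra. }
  assert (Hux0 : ux a s <= 0).
  { destruct (Rle_dec (ux a s) 0) as [|Hn]; [assumption|exfalso].
    (* As [u a s = 0], a positive slope would make [u] positive just to the right of [a], and the
       integral would exceed its maximum at a nearby [b < lam]. *)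
    destruct (is_derive_pos_right _ _ _ (Hux a s Ha' Hs')) as [d [Hd Hr]]; [lra|].
    set (b := a + Rmin d (lam - a) / 2).
    assert (0 < Rmin d (lam - a)) by (apply Rmin_pos; lra).
    pose proof (Rmin_l d (lam - a)); pose proof (Rmin_r d (lam - a)).
    assert (Hb : a < b < a + d /\ b < lam) by (unfold b; lra).
    assert (0 < RInt (fun y => rho y * u y s) a b).
    { apply RInt_gt_0; [lra | |].
      - intros y Hy; apply Rmult_lt_0_compat; [apply Hpos; lra|].
        rewrite <- Hu0; apply Hr; lra.
      - intros y _; apply continuity_continuous, Hc. }
    assert (E : Z b s = Z a s + RInt (fun y => rho y * u y s) a b).
    { unfold Z; symmetry; apply (RInt_Chasles (fun y => rho y * u y s));
        apply ex_RInt_continuity, Hc. }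
    assert (Z b s <= Z a s) by (apply Hmax; lra).
    lra. }
  assert (0 <= RInt (fun y => rho y * ut y s) 0 a).
  (* The maximum may be attained at the final time [t1], so only earlier times are compared; the
     window of length [s] reaches back to time 0. *)
  { apply (is_derive_left_max (fun s => Z a s) s _ s); [lra | |].
    - intros r Hr; apply Hmax; lra.
    - apply (is_derive_RInt_time (fun y s => rho y * u y s)
        (fun y s => rho y * ut y s) T); [exact Hs' | exact Hc | |].
      + intros y r; apply continuity_2d_pt_mult; auto.
      + intros y r Hr.
        apply (is_derive_scal (fun r => u y r) r (rho y)), Hutd, Hr. }
  pose proof (Hsub a s Ha' (conj (proj1 Hs') (proj2 Hs)) Hu0 Hux0).
  lra.
Qed.

(** * Comparison with the exponential barrier *)

Lemma RInt_derive_open (f F : R -> R) (x : R) :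
  0 <= x -> continuity f -> (forall y, 0 <= y <= x -> continuity_pt F y) ->
  (forall y, 0 < y < x -> is_derive F y (f y)) ->
  RInt f 0 x = F x - F 0.
Proof.
  intros Hx Hf HF Hd.
  (* The difference is continuous up to the endpoints and has zero derivative inside, so the mean
     value theorem makes it constant. No derivative of [F] at the vacuum boundary is involved. *)
  destruct (MVT_gen (fun y => RInt f 0 y - F y) 0 x (fun _ => 0)) as [z [_ E]].
  - intros y Hy; rewrite Rmin_left, Rmax_right in Hy by lra.
    pose proof (is_derive_minus _ _ y _ _ (is_derive_RInt_upper f y Hf) (Hd y Hy)) as D.
    rewrite minus_eq_zero in D; exact D.
  - intros y Hy; rewrite Rmin_left, Rmax_right in Hy by lra.
    apply continuity_pt_minus; [|apply HF, Hy].
    apply continuity_pt_filterlim, (ex_derive_continuous (fun y => RInt f 0 y)).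
    eexists; apply is_derive_RInt_upper, Hf.
  - rewrite RInt_point in E; unfold zero in E; simpl in E; lra.
Qed.

Lemma exp_nondecreasing (x y : R) : x <= y -> exp x <= exp y.
Proof.
  intros [H|H]; [left; apply exp_increasing, H | right; rewrite H; reflexivity].
Qed.

Lemma RInt_exp_affine (b k x : R) :
  b <> 0 -> RInt (fun y => b * exp (b * y + k)) 0 x = exp (b * x + k) - exp k.
Proof.
  intros Hb.
  replace (exp k) with (exp (b * 0 + k)) by (f_equal; ring).
  apply is_RInt_unique.
  apply (is_RInt_derive (fun y => exp (b * y + k))).
  - intros y _; auto_derive; [exact I | ring].
  - intros y _; apply (ex_derive_continuous (fun y => b * exp (b * y + k))).
    auto_derive; exact I.
Qed.

(** The energy and the flow map enter only through the stress [S]: its flux form, its bound where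
    [vx <= 0], and its vanishing at the wall. This isolates the comparison argument from the full
    system. *)
Lemma no_one_sided_flow (kap lam T : R) (rho : R -> R) (v vx vt S : R -> R -> R) :
  0 < kap -> 0 < lam -> 0 < T ->
  continuity rho -> (forall x, 0 < x <= lam -> 0 < rho x) ->
  (forall x t, continuity_2d_pt v x t) -> (forall x t, continuity_2d_pt vt x t) ->
  (forall x t, 0 <= x < lam -> 0 < t < T -> continuity_pt (fun y => S y t) x) ->
  (forall x t, 0 < x < lam -> 0 < t < T -> is_derive (fun y => v y t) x (vx x t)) ->
  (forall x t, 0 < t < T -> is_derive (fun s => v x s) t (vt x t)) ->
  (forall x t, 0 < x < lam -> 0 < t < T ->
     is_derive (fun y => S y t) x (rho x * vt x t)) ->
  (forall x t, 0 < x < lam -> 0 < t < T -> vx x t <= 0 -> S x t <= kap * vx x t) ->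
  (forall t, 0 < t < T -> S 0 t = 0) ->
  (forall t, 0 < t < T -> v 0 t = 0) ->
  (forall x, 0 < x <= lam -> v x 0 <= 0) -> v lam 0 < 0 ->
  False.
Proof.
  intros Hk Hlam HT Hrho Hpos Hv Hvt HS Hvx Hvtd HSx HSle HS0 Hv0 Hini Hneg.
  assert (Hrho2 : forall x t, continuity_2d_pt (fun y _ => rho y) x t).
  { intros y s; apply (continuity_1d_2d_pt_comp rho (fun y _ => y));
      [apply Hrho | apply continuity_2d_pt_id1]. }
  assert (Hf : forall x t, continuity_2d_pt (fun y s => rho y * v y s) x t).
  { intros y s; apply continuity_2d_pt_mult; auto. }
  assert (Hc : forall s, continuity (fun y => rho y * v y s)).
  { intros s y; apply (continuity_2d_pt_fst (fun y s => rho y * v y s)), Hf. }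
  pose (W := fun t => RInt (fun y => rho y * v y t) 0 lam).
  assert (HW0 : W 0 < 0).
  { assert (Hcv : continuity_pt (fun x => v x 0) lam) by apply (continuity_2d_pt_fst v), Hv.
    destruct (Hcv (- v lam 0)) as [d [Hd H]]; [lra|].
    (* On [(a, lam)] continuity keeps [v] strictly negative at time 0, which makes the whole
       weighted integral strictly negative. *)
    set (a := lam - Rmin d lam / 2).
    assert (0 < Rmin d lam) by (apply Rmin_pos; lra).
    pose proof (Rmin_l d lam); pose proof (Rmin_r d lam).
    assert (Ha : 0 < a < lam /\ lam - d < a) by (unfold a; lra).
    assert (A1 : RInt (fun y => rho y * v y 0) 0 a <= 0).
    { apply RInt_nonpos; [lra | apply Hc|]; intros y Hy.
      specialize (Hpos y); specialize (Hini y); nra. }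
    assert (A2 : 0 < RInt (fun y => - (rho y * v y 0)) a lam).
    { apply RInt_gt_0; [lra | |].
      - intros y Hy.
        assert (Hvy : v y 0 < 0).
        { assert (Hab : Rabs (v y 0 - v lam 0) < - v lam 0).
          { apply H; split; [split; [exact I | lra]|].
            simpl; unfold R_dist; split_Rabs; lra. }
          split_Rabs; lra. }
        specialize (Hpos y); nra.
      - intros y _; apply continuity_continuous, continuity_pt_opp, Hc. }
    rewrite (RInt_opp (fun y => rho y * v y 0)) in A2
      by (apply ex_RInt_continuity, Hc).
    unfold W; rewrite <- (RInt_Chasles (fun y => rho y * v y 0) 0 a lam)
      by (apply ex_RInt_continuity, Hc).
    unfold opp, plus in *; simpl in *; lra. }
  assert (HWc : continuity_pt W 0).
  { apply (continuity_2d_pt_snd (fun x t => RInt (fun y => rho y * v y t) 0 x)).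
    apply (continuity_2d_RInt (fun y s => rho y * v y s)), Hf. }
  (* Up to [t1] half of the initial negativity of [W] survives; this is the room available to the
     barrier at [x = lam]. *)
  destruct (HWc (- W 0 / 2)) as [d [Hd HWd]]; [lra|].
  set (t1 := Rmin d T / 2).
  assert (Ht1 : 0 < t1 < T /\ t1 < d).
  { assert (0 < Rmin d T) by (apply Rmin_pos; lra).
    pose proof (Rmin_l d T); pose proof (Rmin_r d T); unfold t1; lra. }
  clearbody t1.
  assert (HWneg : forall t, 0 <= t <= t1 -> W t <= W 0 / 2).
  { intros t Ht; destruct (Req_dec t 0) as [->|Hn]; [lra|].
    assert (Hab : Rabs (W t - W 0) < - W 0 / 2).
    { apply HWd; split; [split; [exact I | lra]|].
      simpl; unfold R_dist; split_Rabs; lra. }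
    split_Rabs; lra. }
  destruct (continuity_ab_maj rho 0 lam) as [xm [HR Hxm]]; [lra | intros; apply Hrho|].
  set (r := rho xm) in *.
  assert (Hr : 0 < r).
  { apply Rlt_le_trans with (rho lam); [apply Hpos; lra | apply HR; lra]. }
  (* The two constants are tuned together: [r * k = kap * b ^ 2] makes the barrier a supersolution
     because [rho <= r], and [k * t1 = 2 * (b * lam)] makes [g 0 t1] positive although [g] is
     nonpositive at time 0. *)
  set (b := 2 * r * lam / (kap * t1)).
  assert (Hb : 0 < b).
  { unfold b; apply Rdiv_lt_0_compat; repeat apply Rmult_lt_0_compat; lra. }
  set (k := kap * b ^ 2 / r).
  assert (Hk0 : 0 < k).
  { unfold k; apply Rdiv_lt_0_compat; [|lra].
    apply Rmult_lt_0_compat; [lra | apply pow_lt; lra]. }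
  assert (Hkt : k * t1 = 2 * (b * lam)).
  { unfold k, b; field; lra. }
  assert (Hkr : r * k = kap * b ^ 2) by (unfold k; field; lra).
  clearbody k; clearbody b.
  assert (Hbl : 0 < b * lam) by (apply Rmult_lt_0_compat; lra).
  set (g := fun x t => exp (b * x + k * t) - exp (b * lam)).
  set (gmax := exp (b * lam + k * t1)).
  assert (Hgmax : 0 < gmax) by apply exp_pos.
  assert (Hg : forall x t, 0 <= x <= lam -> 0 <= t <= t1 -> g x t <= gmax).
  { intros x t Hx Ht; unfold g, gmax.
    assert (exp (b * x + k * t) <= exp (b * lam + k * t1)).
    { apply exp_nondecreasing; apply Rplus_le_compat; apply Rmult_le_compat_l; lra. }
    pose proof (exp_pos (b * lam)); lra. }
  assert (Hgini : forall x, 0 <= x <= lam -> g x 0 <= 0).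
  { intros x Hx; unfold g.
    assert (exp (b * x + k * 0) <= exp (b * lam)); [|lra].
    apply exp_nondecreasing; rewrite Rmult_0_r, Rplus_0_r; apply Rmult_le_compat_l; lra. }
  (* With this [c], the integral of [rho * (c * g)] over [[0, lam]] is at most [- W 0 / 2], exactly
     what the bound [W t <= W 0 / 2] can absorb. *)
  set (c := - W 0 / 2 / (r * lam * gmax)).
  assert (Hden : 0 < r * lam * gmax) by (repeat apply Rmult_lt_0_compat; lra).
  assert (Hc0 : 0 < c) by (unfold c; apply Rdiv_lt_0_compat; lra).
  assert (HcW : (lam - 0) * (r * (c * gmax)) = - W 0 / 2) by (unfold c; field; lra).
  clearbody c.
  assert (Hgc : forall x t, continuity_2d_pt (fun y s => exp (b * y + k * s)) x t).
  { intros x t.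
    apply (continuity_1d_2d_pt_comp exp (fun y s => b * y + k * s)).
    - apply derivable_continuous_pt, derivable_pt_exp.
    - apply continuity_2d_pt_plus; apply continuity_2d_pt_mult;
        try apply continuity_2d_pt_const;
        [apply continuity_2d_pt_id1 | apply continuity_2d_pt_id2]. }
  assert (Hrg : forall t, continuity (fun y => rho y * (c * g y t))).
  { intros t y; apply (continuity_2d_pt_fst (fun y s => rho y * (c * g y s))).
    apply continuity_2d_pt_mult; [apply Hrho2|].
    apply continuity_2d_pt_mult; [apply continuity_2d_pt_const|].
    apply continuity_2d_pt_minus; [apply Hgc | apply continuity_2d_pt_const]. }
  pose (u := fun x t => v x t + c * g x t).
  pose (ux := fun x t => vx x t + c * (b * exp (b * x + k * t))).
  pose (ut := fun x t => vt x t + c * (k * exp (b * x + k * t))).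
  assert (Hu : forall x t, continuity_2d_pt u x t).
  { intros x t; apply continuity_2d_pt_plus; [apply Hv|].
    apply continuity_2d_pt_mult; [apply continuity_2d_pt_const|].
    apply continuity_2d_pt_minus; [apply Hgc | apply continuity_2d_pt_const]. }
  assert (Hru : forall t, continuity (fun y => rho y * u y t)).
  { intros t y; apply (continuity_2d_pt_fst (fun y s => rho y * u y s)).
    apply continuity_2d_pt_mult; auto. }
  assert (Hprinciple : forall x t, 0 <= x <= lam -> 0 <= t <= t1 ->
            RInt (fun y => rho y * u y t) 0 x <= 0).
  { apply (integrated_max_principle rho u ux ut lam t1 T).
    - exact Hlam.
    - lra.
    - exact Hrho.
    - intros x Hx; apply Hpos; lra.
    - exact Hu.
    - intros x t; apply continuity_2d_pt_plus; [apply Hvt|].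
      apply continuity_2d_pt_mult; [apply continuity_2d_pt_const|].
      apply continuity_2d_pt_mult; [apply continuity_2d_pt_const | apply Hgc].
    - intros x t Hx Ht.
      apply (is_derive_plus (fun y => v y t) (fun y => c * g y t)).
      + apply Hvx; assumption.
      + unfold g; auto_derive; [exact I | ring].
    - intros x t Ht.
      apply (is_derive_plus (fun s => v x s) (fun s => c * g x s)).
      + apply Hvtd; assumption.
      + unfold g; auto_derive; [exact I | ring].
    - intros x t Hx Ht _ Hux; unfold ux in Hux; unfold ut.
      pose proof (exp_pos (b * x + k * t)) as He.
      assert (Hbe : 0 < c * (b * exp (b * x + k * t))).
      { repeat apply Rmult_lt_0_compat; lra. }
      assert (Hrv : continuity (fun y => rho y * vt y t)).
      { intros y; apply (continuity_2d_pt_fst (fun y s => rho y * vt y s)).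
        apply continuity_2d_pt_mult; auto. }
      assert (Hre : continuity (fun y => rho y * (c * (k * exp (b * y + k * t))))).
      { intros y; apply (continuity_2d_pt_fst
          (fun y s => rho y * (c * (k * exp (b * y + k * s))))).
        apply continuity_2d_pt_mult; [apply Hrho2|].
        apply continuity_2d_pt_mult; [apply continuity_2d_pt_const|].
        apply continuity_2d_pt_mult; [apply continuity_2d_pt_const | apply Hgc]. }
      assert (E1 : RInt (fun y => rho y * vt y t) 0 x = S x t).
      { rewrite (RInt_derive_open _ (fun y => S y t)).
        - rewrite HS0 by lra; apply Rminus_0_r.
        - lra.
        - exact Hrv.
        - intros y Hy; apply HS; lra.
        - intros y Hy; apply HSx; lra. }
      (* Replacing [rho] by its maximum [r] and [r * k] by [kap * b ^ 2] turns the integrand into an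
         exact derivative in [y]. *)
      assert (E2 : RInt (fun y => rho y * (c * (k * exp (b * y + k * t)))) 0 x
                   <= c * kap * b * (exp (b * x + k * t) - exp (k * t))).
      { rewrite <- RInt_exp_affine by lra.
        assert (Hce : continuity (fun y => b * exp (b * y + k * t))).
        { intros y; apply (continuity_2d_pt_fst (fun y s => b * exp (b * y + k * s))).
          apply continuity_2d_pt_mult; [apply continuity_2d_pt_const | apply Hgc]. }
        rewrite <- (RInt_scal (V := R_CompleteNormedModule) (fun y => b * exp (b * y + k * t)))
          by (apply ex_RInt_continuity, Hce).
        apply RInt_le; [lra | apply ex_RInt_continuity, Hre | |].
        - apply ex_RInt_continuity; intros y.
          apply (continuity_pt_mult (fun _ => c * kap * b));
            [apply continuity_pt_const; intros ? ?; reflexivity | apply Hce].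
        - intros y Hy; unfold scal; simpl; unfold mult; simpl.
          pose proof (exp_pos (b * y + k * t)).
          assert (rho y <= r) by (apply HR; lra).
          replace (c * kap * b * (b * exp (b * y + k * t)))
            with (r * k * (c * exp (b * y + k * t))) by (rewrite Hkr; ring).
          replace (r * k * (c * exp (b * y + k * t)))
            with (r * (c * (k * exp (b * y + k * t)))) by ring.
          apply Rmult_le_compat_r; [|assumption].
          left; repeat apply Rmult_lt_0_compat; lra. }
      assert (E3 : S x t <= kap * vx x t) by (apply HSle; lra).
      assert (E4 : RInt (fun y => rho y * (vt y t + c * (k * exp (b * y + k * t)))) 0 x
        = S x t + RInt (fun y => rho y * (c * (k * exp (b * y + k * t)))) 0 x).
      { rewrite <- E1.
        rewrite <- (RInt_plus (fun y => rho y * vt y t)) by (apply ex_RInt_continuity; assumption).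
        apply RInt_ext; intros y _; apply Rmult_plus_distr_l. }
      rewrite E4.
      (* This lower-endpoint term supplies the strict inequality: the terms in [exp (b * x + k * t)]
         cancel against the bound on [kap * vx x t], leaving at most its negative. *)
      assert (0 < c * kap * b * exp (k * t)).
      { repeat apply Rmult_lt_0_compat; try lra; apply exp_pos. }
      assert (kap * vx x t <= kap * (- (c * (b * exp (b * x + k * t))))).
      { apply Rmult_le_compat_l; lra. }
      lra.
    - intros t Ht.
      assert (E : RInt (fun y => rho y * u y t) 0 lam
        = W t + RInt (fun y => rho y * (c * g y t)) 0 lam).
      { unfold W; rewrite <- (RInt_plus (fun y => rho y * v y t)).
        - apply RInt_ext; intros y _; apply Rmult_plus_distr_l.
        - apply ex_RInt_continuity, Hc.
        - apply ex_RInt_continuity, Hrg. }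
      assert (RInt (fun y => rho y * (c * g y t)) 0 lam <= RInt (fun _ => r * (c * gmax)) 0 lam).
      { apply RInt_le; [lra | apply ex_RInt_continuity, Hrg | apply ex_RInt_const |].
        intros y Hy.
        assert (g y t <= gmax) by (apply Hg; lra).
        assert (0 < rho y <= r) by (split; [apply Hpos; lra | apply HR; lra]).
        apply Rle_trans with (rho y * (c * gmax)).
        - apply Rmult_le_compat_l; [lra | apply Rmult_le_compat_l; lra].
        - apply Rmult_le_compat_r; [|lra].
          left; apply Rmult_lt_0_compat; lra. }
      rewrite RInt_const in H; unfold scal in H; simpl in H; unfold mult in H; simpl in H.
      rewrite HcW in H; specialize (HWneg t Ht); lra.
    - intros x Hx; apply RInt_nonpos; [lra | apply Hru|].
      intros y Hy; unfold u.
      assert (v y 0 <= 0) by (apply Hini; lra).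
      assert (c * g y 0 <= 0).
      { assert (g y 0 <= 0) by (apply Hgini; lra).
        nra. }
      assert (0 < rho y) by (apply Hpos; lra).
      nra. }
  (* At the wall [v] vanishes and only the barrier remains, with [k * t1 = 2 * (b * lam) > b * lam].
     Positivity persists for small [y], contradicting the comparison. *)
  assert (Hu0 : 0 < u 0 t1).
  { unfold u; rewrite Hv0, Rplus_0_l by lra.
    apply Rmult_lt_0_compat; [exact Hc0|].
    assert (exp (b * lam) < exp (b * 0 + k * t1)) by (apply exp_increasing; lra).
    unfold g; lra. }
  destruct (continuity_2d_pt_fst u 0 t1 (Hu 0 t1) (u 0 t1) Hu0) as [e [He Hnear]].
  set (x := Rmin e lam).
  assert (Hx : 0 < x) by (apply Rmin_pos; lra).
  pose proof (Rmin_l e lam); pose proof (Rmin_r e lam).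
  assert (0 < RInt (fun y => rho y * u y t1) 0 x).
  { apply RInt_gt_0; [exact Hx | |].
    - intros y Hy; fold x in H, H0; apply Rmult_lt_0_compat; [apply Hpos; lra|].
      assert (Hab : Rabs (u y t1 - u 0 t1) < u 0 t1).
      { apply Hnear; split; [split; [exact I | lra]|].
        simpl; unfold R_dist; split_Rabs; lra. }
      split_Rabs; lra.
    - intros y _; apply continuity_continuous, Hru. }
  assert (RInt (fun y => rho y * u y t1) 0 x <= 0) by (apply Hprinciple; unfold x in *; lra).
  lra.
Qed.

(** * Transfer to data on the closed interval, and reflection *)

Lemma cont_rect_restrict (T T1 : R) (f : R -> R -> R) :
  T1 <= T -> cont_rect T f -> cont_rect T1 f.
Proof.
  intros HT Hf x t Hx [Ht Ht'] eps Heps.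
  destruct (Hf x t Hx (conj Ht (Rle_trans _ _ _ Ht' HT)) eps Heps) as [d [Hd H]].
  exists d; split; [exact Hd|]; intros y s Hy [Hs Hs'].
  apply H; [exact Hy | split; lra].
Qed.

Lemma deriv_within_interior (D : R -> Prop) (f : R -> R) (x l r : R) :
  0 < r -> (forall y, x - r < y < x + r -> D y) ->
  deriv_within D f x l -> derivable_pt_lim f x l.
Proof.
  intros Hr HD Hf eps Heps; destruct (Hf eps Heps) as [d [Hd H]].
  assert (Hm : 0 < Rmin d r) by (apply Rmin_pos; assumption).
  exists (mkposreal _ Hm); simpl; intros h Hh Hhd.
  pose proof (Rmin_l d r); pose proof (Rmin_r d r).
  apply H; [exact Hh | lra | apply HD; split_Rabs; lra].
Qed.

Lemma deriv_within_open (a b : R) (D : R -> Prop) (f : R -> R) (x l : R) :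
  a < x < b -> (forall y, a < y < b -> D y) ->
  deriv_within D f x l -> derivable_pt_lim f x l.
Proof.
  intros Hx HD; pose proof (Rmin_l (x - a) (b - x)); pose proof (Rmin_r (x - a) (b - x)).
  apply (deriv_within_interior D f x l (Rmin (x - a) (b - x))).
  - apply Rmin_pos; lra.
  - intros y Hy; apply HD; lra.
Qed.

Lemma derivable_pt_lim_clamp (a : R) (f : R -> R) (x l : R) :
  0 < x < a -> derivable_pt_lim f x l -> is_derive (fun y => f (clamp a y)) x l.
Proof.
  intros Hx Hf; apply is_derive_ext_loc with f; [|apply is_derive_Reals, Hf].
  assert (Hloc : locally x (fun y => 0 < y < a)).
  { apply (open_and (fun y => 0 < y) (fun y => y < a));
      [apply open_gt | apply open_lt | exact Hx]. }
  revert Hloc; apply filter_imp; intros y Hy; rewrite clamp_id by lra; reflexivity.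
Qed.

(** Clamping space and time supplies the global continuity that the comparison asks for and leaves
    derivatives at interior points unchanged. *)
Lemma no_one_sided_flow_left (kap lam T : R) (rho : R -> R) (v vx vt S : R -> R -> R) :
  0 < kap -> 0 < lam < 1 -> 0 < T ->
  cont_closedI rho -> (forall x, openI x -> 0 < rho x) ->
  cont_rect T v -> cont_rect T vt ->
  (forall t, 0 < t < T -> continuity (fun x => S (clamp 1 x) t)) ->
  (forall x t, openI x -> 0 < t < T -> derivable_pt_lim (fun y => v y t) x (vx x t)) ->
  (forall x t, closedI x -> 0 < t < T -> derivable_pt_lim (fun s => v x s) t (vt x t)) ->
  (forall x t, openI x -> 0 < t < T ->
     derivable_pt_lim (fun y => S y t) x (rho x * vt x t)) ->
  (forall x t, openI x -> 0 < t < T -> vx x t <= 0 -> S x t <= kap * vx x t) ->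
  (forall t, 0 < t < T -> S 0 t = 0) ->
  (forall t, 0 < t < T -> v 0 t = 0) ->
  (forall x, 0 < x < lam -> v x 0 <= 0) -> v lam 0 < 0 ->
  False.
Proof.
  unfold openI, closedI.
  intros Hk Hlam HT Hrho Hpos Hv Hvt HS Hvx Hvtd HSx HSle HS0 Hv0 Hini Hneg.
  assert (HI : forall x, 0 <= clamp 1 x <= 1) by (intros; apply clamp_in; lra).
  apply (no_one_sided_flow kap lam T (fun x => rho (clamp 1 x))
    (fun x t => v (clamp 1 x) (clamp T t)) (fun x t => vx (clamp 1 x) t)
    (fun x t => vt (clamp 1 x) (clamp T t)) (fun x t => S (clamp 1 x) t)).
  - exact Hk.
  - lra.
  - exact HT.
  - apply cont_closedI_clamp, Hrho.
  - intros x Hx; rewrite clamp_id by lra; apply Hpos; lra.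
  - apply cont_rect_clamp; [lra | exact Hv].
  - apply cont_rect_clamp; [lra | exact Hvt].
  - intros x t _ Ht; apply HS, Ht.
  - intros x t Hx Ht; rewrite (clamp_id T t), (clamp_id 1 x) by lra.
    apply (derivable_pt_lim_clamp 1 (fun y => v y t)); [lra | apply Hvx; lra].
  - intros x t Ht; rewrite (clamp_id T t) by lra.
    apply (derivable_pt_lim_clamp T (fun s => v (clamp 1 x) s)); [lra | apply Hvtd; auto].
  - intros x t Hx Ht; rewrite (clamp_id T t), (clamp_id 1 x) by lra.
    apply (derivable_pt_lim_clamp 1 (fun y => S y t)); [lra | apply HSx; lra].
  - intros x t Hx Ht; rewrite (clamp_id 1 x) by lra; apply HSle; lra.
  - intros t Ht; rewrite (clamp_id 1 0) by lra; apply HS0, Ht.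
  - intros t Ht; rewrite (clamp_id 1 0), (clamp_id T t) by lra; apply Hv0, Ht.
  - intros x Hx; rewrite (clamp_id 1 x), (clamp_id T 0) by lra.
    destruct (Req_dec x lam) as [->|Hn]; [lra | apply Hini; lra].
  - rewrite (clamp_id 1 lam), (clamp_id T 0) by lra; exact Hneg.
Qed.

Lemma clamp_reflect (x : R) : clamp 1 (1 - x) = 1 - clamp 1 x.
Proof.
  unfold clamp, Rmax, Rmin.
  destruct (Rle_dec 1 (1 - x)); destruct (Rle_dec 1 x);
    repeat destruct (Rle_dec 0 _); lra.
Qed.

Lemma cont_rect_reflect (T : R) (f : R -> R -> R) :
  cont_rect T f -> cont_rect T (fun x t => - f (1 - x) t).
Proof.
  unfold cont_rect, closedI; intros Hf x t Hx Ht eps Heps.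
  destruct (Hf (1 - x) t ltac:(lra) Ht eps Heps) as [d [Hd H]].
  exists d; split; [exact Hd|]; intros y s Hy Hs Hyd Hsd.
  specialize (H (1 - y) s ltac:(lra) Hs ltac:(split_Rabs; lra) Hsd).
  split_Rabs; lra.
Qed.

Lemma derivable_pt_lim_reflect (f : R -> R) (x l : R) :
  derivable_pt_lim f (1 - x) l -> derivable_pt_lim (fun y => f (1 - y)) x (- l).
Proof.
  intros Hf; apply is_derive_Reals; apply is_derive_Reals in Hf.
  replace (- l) with (scal (-1) l) by (unfold scal; simpl; unfold mult; simpl; ring).
  apply (is_derive_comp f (fun y => 1 - y)); [exact Hf|].
  auto_derive; [exact I | ring].
Qed.

(** Under [x -> 1 - x], [v -> - v] the two sign changes cancel in [vx], so the stress bound is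
    preserved, while the space derivative of [S] and [vt] both change sign, so the momentum balance
    is preserved. *)
Lemma no_one_sided_flow_right (kap lam T : R) (rho : R -> R) (v vx vt S : R -> R -> R) :
  0 < kap -> 0 < lam < 1 -> 0 < T ->
  cont_closedI rho -> (forall x, openI x -> 0 < rho x) ->
  cont_rect T v -> cont_rect T vt ->
  (forall t, 0 < t < T -> continuity (fun x => S (clamp 1 x) t)) ->
  (forall x t, openI x -> 0 < t < T -> derivable_pt_lim (fun y => v y t) x (vx x t)) ->
  (forall x t, closedI x -> 0 < t < T -> derivable_pt_lim (fun s => v x s) t (vt x t)) ->
  (forall x t, openI x -> 0 < t < T ->
     derivable_pt_lim (fun y => S y t) x (rho x * vt x t)) ->
  (forall x t, openI x -> 0 < t < T -> vx x t <= 0 -> S x t <= kap * vx x t) ->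
  (forall t, 0 < t < T -> S 1 t = 0) ->
  (forall t, 0 < t < T -> v 1 t = 0) ->
  (forall x, lam < x < 1 -> 0 <= v x 0) -> 0 < v lam 0 ->
  False.
Proof.
  unfold openI, closedI.
  intros Hk Hlam HT Hrho Hpos Hv Hvt HS Hvx Hvtd HSx HSle HS0 Hv0 Hini Hneg.
  apply (no_one_sided_flow_left kap (1 - lam) T (fun x => rho (1 - x))
    (fun x t => - v (1 - x) t) (fun x t => vx (1 - x) t)
    (fun x t => - vt (1 - x) t) (fun x t => S (1 - x) t)); unfold openI, closedI.
  - exact Hk.
  - lra.
  - exact HT.
  - unfold cont_closedI, closedI in *; intros x Hx eps Heps.
    destruct (Hrho (1 - x) ltac:(lra) eps Heps) as [d [Hd H]].
    exists d; split; [exact Hd|]; intros y Hy Hyd.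
    apply H; [lra | split_Rabs; lra].
  - intros x Hx; apply Hpos; lra.
  - apply cont_rect_reflect, Hv.
  - apply cont_rect_reflect, Hvt.
  - intros t Ht.
    intros x; apply (continuity_pt_ext (fun x => S (clamp 1 (1 - x)) t)).
    + intros y; rewrite clamp_reflect; reflexivity.
    + apply (continuity_pt_comp (fun x => 1 - x) (fun x => S (clamp 1 x) t)).
      * apply continuity_pt_minus;
          [apply continuity_pt_const; intros ? ?; reflexivity | apply continuity_pt_id].
      * apply HS, Ht.
  - intros x t Hx Ht.
    rewrite <- (Ropp_involutive (vx (1 - x) t)).
    apply (derivable_pt_lim_opp (fun y => v (1 - y) t)).
    apply (derivable_pt_lim_reflect (fun y => v y t)), Hvx; lra.
  - intros x t Hx Ht; apply (derivable_pt_lim_opp (fun s => v (1 - x) s)), Hvtd; lra.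
  - intros x t Hx Ht; rewrite Ropp_mult_distr_r_reverse.
    apply (derivable_pt_lim_reflect (fun y => S y t)), HSx; lra.
  - intros x t Hx Ht; apply HSle; lra.
  - intros t Ht; rewrite Rminus_0_r; apply HS0, Ht.
  - intros t Ht; rewrite Rminus_0_r, Hv0 by exact Ht; ring.
  - intros x Hx; specialize (Hini (1 - x)); lra.
  - replace (1 - (1 - lam)) with lam by ring; lra.
Qed.

(** * Propagation of nonnegativity in time *)

Lemma nonneg_of_linear_lower_bound (f df : R -> R) (N t1 T : R) :
  0 < t1 < T -> continuity f -> (forall t, 0 < t < T -> is_derive f t (df t)) ->
  (forall t, 0 < t < T -> f t < 0 -> N * f t < df t) -> 0 <= f 0 ->
  forall t, 0 <= t <= t1 -> 0 <= f t.
Proof.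
  intros Ht1 Hf Hd Hlow H0 t Ht.
  destruct (Rle_dec 0 (f t)) as [|Hn]; [assumption|exfalso].
  (* The integrating factor reduces the claim to a sign of derivative: a positive maximum of [g]
     occurs at a time [s > 0] with [f s < 0], where [N * f s < df s] makes the derivative of [g]
     negative, against maximality from the left. *)
  pose (g := fun t => - (f t * exp (- N * t))).
  destruct (continuity_ab_maj g 0 t1) as [s [Hmax Hs]]; [lra | |].
  { intros c _; apply continuity_pt_opp, continuity_pt_mult; [apply Hf|].
    apply continuity_pt_filterlim, (ex_derive_continuous (fun t => exp (- N * t))).
    auto_derive; exact I. }
  pose proof (exp_pos (- N * t)); pose proof (exp_pos (- N * s)).
  assert (Hgs : 0 < g s).
  { apply Rlt_le_trans with (g t); [unfold g; nra | apply Hmax, Ht]. }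
  assert (Hfs : f s < 0) by (unfold g in Hgs; nra).
  assert (Hs0 : s <> 0) by (intros E; subst s; lra).
  assert (Hder : is_derive g s (- ((df s - N * f s) * exp (- N * s)))).
  { apply (is_derive_opp (fun t => f t * exp (- N * t))).
    assert (Dm : is_derive (fun t => f t * exp (- N * t)) s
       (df s * exp (- N * s) + f s * (- N * exp (- N * s)))).
    { apply (is_derive_mult f (fun t => exp (- N * t))).
      - apply Hd; lra.
      - auto_derive; [exact I | ring].
      - intros; apply Rmult_comm. }
    replace ((df s - N * f s) * exp (- N * s))
      with (df s * exp (- N * s) + f s * (- N * exp (- N * s))) by ring.
    exact Dm. }
  assert (0 <= - ((df s - N * f s) * exp (- N * s))).
  { apply (is_derive_left_max g s _ s); [lra | | exact Hder].
    intros r Hr; apply Hmax; lra. }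
  assert (N * f s < df s) by (apply Hlow; lra).
  nra.
Qed.

(** * Small-time bounds and reduction of the system to a one-sided flow *)

Theorem theorem3p2
  (mu gamma : R) (rho0 u0 e0 : R -> R)
  (Hmu : 0 < mu) (Hgamma : 1 < gamma)
  (Hrho_c : cont_closedI rho0)
  (Hrho_pos : forall x, openI x -> 0 < rho0 x)
  (Hrho_0 : rho0 0 = 0) (Hrho_1 : rho0 1 = 0)
  (Hu0_c : cont_closedI u0) (He0_c : cont_closedI e0)
  (He0_nn : forall x, closedI x -> 0 <= e0 x)
  (He0_nz : exists x, closedI x /\ e0 x <> 0)
  (Hcase : exists l5 l6 l7 l8 : R,
     0 < l5 /\ 0 < l6 /\ 0 < l7 < 1 /\ 0 < l8 < 1 /\
     ( (forall x, 0 < x < l7 ->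
          exists drho de, derivable_pt_lim rho0 x drho /\
            derivable_pt_lim e0 x de /\ drho / rho0 x + de / rho0 x >= l5)
       /\ u0 l7 < 0 /\ (forall x, 0 < x < l7 -> u0 x <= 0)
     \/
       (forall x, l8 < x < 1 ->
          exists drho de, derivable_pt_lim rho0 x drho /\
            derivable_pt_lim e0 x de /\ drho / rho0 x + de / rho0 x <= - l6)
       /\ u0 l8 > 0 /\ (forall x, l8 < x < 1 -> u0 x >= 0) ))
  (T : R) (HT : 0 < T) :
  ~ exists (v e eta vx vxx vt ex exx et etax etaxx etat : R -> R -> R),
      C21 T v vx vxx vt /\ C21 T e ex exx et /\ C21 T eta etax etaxx etat /\
      (* eta_x does not vanish where the equations are posed *)
      (forall x t, openI x -> 0 < t <= T -> etax x t <> 0) /\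
      (* momentum equation *)
      (forall x t, openI x -> 0 < t <= T ->
         exists A B,
           derivable_pt_lim (fun y => rho0 y * e y t / etax y t) x A /\
           derivable_pt_lim (fun y => vx y t / etax y t) x B /\
           rho0 x * vt x t + A = mu * B) /\
      (* energy equation *)
      (forall x t, openI x -> 0 < t <= T ->
         rho0 x * et x t + (gamma - 1) * (rho0 x * e x t * vx x t / etax x t)
         = mu * (vx x t ^ 2 / etax x t)) /\
      (* eta_t = v *)
      (forall x t, openI x -> 0 < t <= T -> etat x t = v x t) /\
      (* initial data *)
      (forall x, openI x -> v x 0 = u0 x /\ e x 0 = e0 x /\ eta x 0 = x) /\
      (* boundary conditions *)
      (forall t, 0 < t <= T ->
         v 0 t = 0 /\ v 1 t = 0 /\ vx 0 t = 0 /\ vx 1 t = 0).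
Proof.
  unfold openI, closedI in *.
  intros (v & e & eta & vx & vxx & vt & ex & exx & et & etax & etaxx & etat &
    (Hvc & Hvxc & _ & Hvtc & Hvd) & (Hec & _ & _ & _ & Hed) & (_ & Hetaxc & _ & _ & Hetad) &
    _ & Hmom & Hen & _ & Hini & Hbd).
  unfold closedI in *.
  assert (Hetax0 : forall x, 0 < x < 1 -> etax x 0 = 1).
  { intros x Hx.
    destruct (Hetad x 0) as [Hd _]; [lra | unfold closedT; lra|].
    apply (deriv_within_open 0 1) in Hd; [| lra | unfold closedI; intros; lra].
    apply (uniqueness_limite (fun y => eta y 0) x); [exact Hd|].
    apply is_derive_Reals, is_derive_ext_loc with (fun y => y); [|apply (is_derive_id x)].
    assert (Hloc : locally x (fun y => 0 < y < 1)).
    { apply (open_and (fun y => 0 < y) (fun y => y < 1));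
        [apply open_gt | apply open_lt | exact Hx]. }
    revert Hloc; apply filter_imp; intros y Hy; symmetry; apply (Hini y Hy). }
  pose (q := fun x t => etax (clamp 1 x) (clamp T t)).
  assert (Hq : forall x t, continuity_2d_pt q x t) by (apply cont_rect_clamp; [lra | assumption]).
  destruct (uniform_continuity_2d q 0 1 0 T (fun x t _ _ => Hq x t)
    (mkposreal (/ 4) ltac:(lra))) as [d Hqd]; simpl in Hqd.
  pose proof (cond_pos d) as Hd0.
  set (T1 := Rmin d T / 2).
  assert (HT1 : 0 < T1 < T /\ T1 < d).
  { assert (0 < Rmin d T) by (apply Rmin_pos; lra).
    pose proof (Rmin_l d T); pose proof (Rmin_r d T); unfold T1; lra. }
  clearbody T1.
  assert (Hetax : forall x t, 0 <= x <= 1 -> 0 <= t <= T1 -> 1 / 2 <= etax x t <= 2).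
  { intros x t Hx Ht.
    (* The initial data are prescribed only in the open interval, so [etax x t] is compared with its
       value 1 at an interior point [y] at time 0; this covers the endpoints too. *)
    assert (exists y, 0 < y < 1 /\ Rabs (y - x) < d) as (y & Hy & Hyx).
    { pose proof (Rmin_l d 1); pose proof (Rmin_r d 1).
      assert (0 < Rmin d 1) by (apply Rmin_pos; lra).
      destruct (Rle_dec x (1 / 2));
        [exists (x + Rmin d 1 / 4) | exists (x - Rmin d 1 / 4)]; split_Rabs; lra. }
    assert (Hqy : Rabs (q x t - q y 0) < / 4).
    { apply Hqd; try lra; split_Rabs; lra. }
    unfold q in Hqy; rewrite !clamp_id in Hqy by lra.
    rewrite Hetax0 in Hqy by exact Hy; split_Rabs; lra. }
  destruct (continuity_2d_rect_bounded (fun x t => vx (clamp 1 x) (clamp T t)) 0 1 0 T)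
    as [M HM]; [apply cont_rect_clamp; [lra | assumption]|].
  assert (HvM : forall x t, 0 <= x <= 1 -> 0 <= t <= T1 -> Rabs (vx x t) <= M).
  { intros x t Hx Ht; specialize (HM x t); rewrite !clamp_id in HM by lra; apply HM; lra. }
  assert (He : forall x t, 0 < x < 1 -> 0 < t < T1 -> 0 <= e x t).
  { intros x t Hx Ht.
    rewrite <- (clamp_id T t) by lra.
    (* As [etax >= 1 / 2], the ratio [vx / etax] is at most [2 * M] in absolute value. The viscous
       heating is nonnegative, so the energy equation gives the linear lower bound where [e < 0];
       the extra 1 makes it strict. *)
    apply (nonneg_of_linear_lower_bound (fun t => e x (clamp T t)) (et x)
      (2 * M * (gamma - 1) + 1) t T1); [lra | | | | |lra].
    - intros s; apply (continuity_pt_ext (fun s => e (clamp 1 x) (clamp T s))).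
      + intros r; rewrite (clamp_id 1 x) by lra; reflexivity.
      + apply (continuity_2d_pt_snd (fun x t => e (clamp 1 x) (clamp T t))).
        apply cont_rect_clamp; [lra | assumption].
    - intros s Hs; apply (derivable_pt_lim_clamp T (fun s => e x s)); [lra|].
      apply (deriv_within_open 0 T (closedT T)); [lra | unfold closedT; intros; lra|].
      apply Hed; unfold closedT; lra.
    - intros s Hs; rewrite (clamp_id T s) by lra; intros Hneg.
      specialize (Hen x s Hx ltac:(lra)); specialize (Hrho_pos x Hx).
      destruct (Hetax x s) as [Hl _]; [lra | lra|].
      pose proof (HvM x s ltac:(lra) ltac:(lra)) as HvMs.
      set (p := vx x s / etax x s) in *.
      assert (Hpe : p * etax x s = vx x s) by (unfold p; field; lra).
      assert (HpM : Rabs p <= 2 * M).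
      { assert (Rabs p * etax x s <= M).
        { rewrite <- (Rabs_pos_eq (etax x s)), <- Rabs_mult, Hpe by lra; exact HvMs. }
        pose proof (Rabs_pos p); nra. }
      assert (Hpos : 0 <= rho0 x * (et x s + (gamma - 1) * (p * e x s))).
      { replace (rho0 x * (et x s + (gamma - 1) * (p * e x s)))
          with (rho0 x * et x s + (gamma - 1) * (rho0 x * e x s * vx x s / etax x s))
          by (unfold p; field; lra).
        rewrite Hen; apply Rmult_le_pos; [lra|].
        apply Rdiv_le_0_compat; [apply pow2_ge_0 | lra]. }
      assert (0 <= et x s + (gamma - 1) * (p * e x s)).
      { apply Rmult_le_reg_l with (rho0 x); [lra|]; rewrite Rmult_0_r; exact Hpos. }
      assert (2 * M * e x s <= - (p * e x s)) by (split_Rabs; nra).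
      assert ((gamma - 1) * (2 * M * e x s) <= (gamma - 1) * - (p * e x s)).
      { apply Rmult_le_compat_l; lra. }
      lra.
    - rewrite (clamp_id T 0) by lra.
      destruct (Hini x Hx) as (_ & -> & _); apply He0_nn; lra. }
  (* Viscous stress minus pressure: the momentum equation says that its space derivative is
     [rho0 * vt], and it vanishes at both walls, where [rho0] and [vx] are zero. *)
  pose (S := fun x t => mu * (vx x t / etax x t) - rho0 x * e x t / etax x t).
  assert (HSc : forall t, 0 < t < T1 -> continuity (fun x => S (clamp 1 x) t)).
  { intros t Ht x.
    assert (Hsl : forall f, cont_rect T f -> continuity_pt (fun x => f (clamp 1 x) t) x).
    { intros f Hf; apply (continuity_pt_ext (fun x => f (clamp 1 x) (clamp T t))).
      - intros y; rewrite (clamp_id T t) by lra; reflexivity.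
      - apply (continuity_2d_pt_fst (fun x t => f (clamp 1 x) (clamp T t))).
        apply cont_rect_clamp; [lra | exact Hf]. }
    assert (Hne : etax (clamp 1 x) t <> 0).
    { destruct (Hetax (clamp 1 x) t); [apply clamp_in; lra | lra | lra]. }
    apply continuity_pt_minus.
    - apply (continuity_pt_mult (fun _ => mu));
        [apply continuity_pt_const; intros ? ?; reflexivity|].
      apply (continuity_pt_div (fun x => vx (clamp 1 x) t) (fun x => etax (clamp 1 x) t));
        [apply Hsl; assumption | apply Hsl; assumption | exact Hne].
    - apply (continuity_pt_div (fun x => rho0 (clamp 1 x) * e (clamp 1 x) t)
        (fun x => etax (clamp 1 x) t)); [| apply Hsl; assumption | exact Hne].
      apply (continuity_pt_mult (fun x => rho0 (clamp 1 x)));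
        [apply cont_closedI_clamp, Hrho_c | apply Hsl; assumption]. }
  assert (HSx : forall x t, 0 < x < 1 -> 0 < t < T1 ->
            derivable_pt_lim (fun y => S y t) x (rho0 x * vt x t)).
  { intros x t Hx Ht; destruct (Hmom x t Hx) as (A & B & HA & HB & E); [lra|].
    replace (rho0 x * vt x t) with (mu * B - A) by lra.
    apply (derivable_pt_lim_minus (fun y => mu * (vx y t / etax y t))); [|exact HA].
    apply (derivable_pt_lim_scal (fun y => vx y t / etax y t)), HB. }
  assert (HSle : forall x t, 0 < x < 1 -> 0 < t < T1 -> vx x t <= 0 ->
            S x t <= mu / 2 * vx x t).
  { intros x t Hx Ht Hn; destruct (Hetax x t) as [Hl Hu]; [lra | lra|].
    assert (0 <= rho0 x * e x t / etax x t).
    { apply Rdiv_le_0_compat; [|lra].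
      apply Rmult_le_pos; [specialize (Hrho_pos x Hx); lra | apply He; assumption]. }
    assert (vx x t / etax x t <= vx x t / 2).
    { apply Rmult_le_reg_r with (etax x t); [lra|].
      replace (vx x t / etax x t * etax x t) with (vx x t) by (field; lra); nra. }
    assert (mu * (vx x t / etax x t) <= mu * (vx x t / 2)) by (apply Rmult_le_compat_l; lra).
    unfold S; lra. }
  assert (HS01 : forall t, 0 < t < T1 -> S 0 t = 0 /\ S 1 t = 0).
  { intros t Ht; destruct (Hbd t) as (_ & _ & H0 & H1); [lra|].
    unfold S; rewrite H0, H1, Hrho_0, Hrho_1; unfold Rdiv; split; ring. }
  assert (Hvx : forall x t, 0 < x < 1 -> 0 < t < T1 ->
            derivable_pt_lim (fun y => v y t) x (vx x t)).
  { intros x t Hx Ht; apply (deriv_within_open 0 1 closedI);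
      [lra | unfold closedI; intros; lra | apply Hvd; unfold closedT; lra]. }
  assert (Hvt : forall x t, 0 <= x <= 1 -> 0 < t < T1 ->
            derivable_pt_lim (fun s => v x s) t (vt x t)).
  { intros x t Hx Ht; apply (deriv_within_open 0 T (closedT T));
      [lra | unfold closedT; intros; lra | apply Hvd; unfold closedT; lra]. }
  assert (Hv1 : cont_rect T1 v) by (apply (cont_rect_restrict T); [lra | assumption]).
  assert (Hvt1 : cont_rect T1 vt) by (apply (cont_rect_restrict T); [lra | assumption]).
  destruct Hcase as (l5 & l6 & l7 & l8 & _ & _ & H7 & H8 & [(_ & Hn & Hs)|(_ & Hn & Hs)]).
  - apply (no_one_sided_flow_left (mu / 2) l7 T1 rho0 v vx vt S);
      try assumption; try lra.
    + intros t Ht; apply HS01, Ht.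
    + intros t Ht; apply Hbd; lra.
    + intros x Hx; destruct (Hini x) as [-> _]; [lra | apply Hs, Hx].
    + destruct (Hini l7 H7) as [-> _]; exact Hn.
  - apply (no_one_sided_flow_right (mu / 2) l8 T1 rho0 v vx vt S);
      try assumption; try lra.
    + intros t Ht; apply HS01, Ht.
    + intros t Ht; apply Hbd; lra.
    + intros x Hx; destruct (Hini x) as [-> _]; [lra | apply Rge_le, Hs, Hx].
    + destruct (Hini l8 H8) as [-> _]; lra.
Qed.
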